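(* Let $\nu$ be a computable probability measure on Cantor space $2^{\mathbb{N}}$ with full support. Then $\mathsf{Mild}^{\nu}\cap \mathsf{CR}^{\nu}\subseteq \mathsf{MR}_0^{\nu}(\ll_{bdc}, \mathscr{F}_{n+1}, T)$.
   Context: A probability measure $\nu$ on Cantor space is identified with the function $\sigma\mapsto\nu(\sigma):=\nu([\sigma])$ on $2^{<\mathbb{N}}$, where $[\sigma]$ is the set of $\omega\in 2^{\mathbb{N}}$ extending $\sigma$. It is computable if the reals $\nu(\sigma)$ are computable uniformly in $\sigma$; it has full support if $\nu(\sigma)>0$ for all $\sigma$. $\omega\upharpoonright n$ is the length-$n$ initial segment of $\omega$. $\mathscr{F}_n$ is the $\sigma$-algebra generated by the sets $[\sigma]$ with $|\sigma|=n$. $\mathsf{Mild}^{\nu}$ is the set of $\omega$ with $\liminf_n \nu([\omega\upharpoonright(n+1)]\mid[\omega\upharpoonright n])>0$. A dyadic $\nu$-martingale is a function $N:2^{<\mathbb{N}}\to\mathbb{R}$ with $N(\sigma)=N(\sigma0)\nu(\sigma0\mid\sigma)+N(\sigma1)\nu(\sigma1\mid\sigma)$ for all $\sigma$ (where $\nu(\sigma\iota\mid\sigma)=\nu(\sigma\iota)/\nu(\sigma)$); it is computable if $N(\sigma)$ is a computable real uniformly in $\sigma$. $\mathsf{CR}^{\nu}$ (computably $\nu$-random points) is the set of $\omega$ such that $\sup_n N(\omega\upharpoonright n)<\infty$ for all computable non-negative dyadic $\nu$-martingales $N$. $\nu\ll_{bdc}\mu$ iff $\mathbb{E}_{\nu}\sup_n\frac{\nu(\cdot\upharpoonright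 n)}{\mu(\cdot\upharpoonright n)}$ (expectation of $\omega\mapsto\sup_n \frac{\nu(\omega\upharpoonright n)}{\mu(\omega\upharpoonright n)}$) is finite and is a computable real. Total variational distance: $T_{\mathscr{F}_{n+1}}(\nu,\mu)(\omega)=\sup_{A\in\mathscr{F}_{n+1}}\big|\nu(A\mid[\omega\upharpoonright n])-\mu(A\mid[\omega\upharpoonright n])\big|$. $\mathsf{MR}^{\nu}_0(\ll_{bdc},\mathscr{F}_{n+1},T)$ is the set of $\omega$ such that for all computable probability measures $\mu$ with full support and $\nu\ll_{bdc}\mu$, one has $\lim_n T_{\mathscr{F}_{n+1}}(\nu,\mu)(\omega)=0$. *)

(* Defs.v *)
From mathcomp Require Import all_boot all_order all_algebra.
From mathcomp Require Import all_classical all_reals all_analysis.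

Set Implicit Arguments.
Unset Strict Implicit.
Unset Printing Implicit Defensive.

Import Order.TTheory GRing.Theory Num.Theory.
Import numFieldNormedType.Exports.

Local Open Scope classical_set_scope.
Local Open Scope ring_scope.

(* Total recursive functions N^k -> N: the least class containing the basic
   functions and closed under composition, primitive recursion and
   minimization of functions that have a zero for all values of the
   parameters. *)
Inductive recursive : forall k : nat, (k.-tuple nat -> nat) -> Prop :=
| recursive_zero (k : nat) : recursive (fun _ : k.-tuple nat => 0%N)
| recursive_succ : recursive (fun v : 1.-tuple nat => (thead v).+1)
| recursive_proj (k : nat) (i : 'I_k) :
    recursive (fun v : k.-tuple nat => tnth v i)
| recursive_comp (k m : nat) (f : m.-tuple nat -> nat)
    (g : 'I_m -> k.-tuple nat -> nat) :
    recursive f -> (forall i, recursive (g i)) ->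
    recursive (fun v : k.-tuple nat => f [tuple g i v | i < m])
| recursive_primrec (k : nat) (f : k.-tuple nat -> nat)
    (g : k.+2.-tuple nat -> nat) (h : k.+1.-tuple nat -> nat) :
    recursive f -> recursive g ->
    (forall v : k.-tuple nat, h [tuple of 0%N :: v] = f v) ->
    (forall (n : nat) (v : k.-tuple nat),
       h [tuple of n.+1 :: v] = g [tuple of n :: h [tuple of n :: v] :: v]) ->
    recursive h
| recursive_min (k : nat) (f : k.+1.-tuple nat -> nat)
    (h : k.-tuple nat -> nat) :
    recursive f ->
    (forall v : k.-tuple nat, f [tuple of h v :: v] = 0%N) ->
    (forall (v : k.-tuple nat) (n : nat),
       (n < h v)%N -> f [tuple of n :: v] <> 0%N) ->
    recursive h.

(* Bijective base-2 numeration, a bijection between binary strings and nat. *)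
Definition string_code (s : seq bool) : nat :=
  foldl (fun c (b : bool) => (c.*2.+1 + b)%N) 0%N s.

(* Every rational is of the form rational_of a b c. *)
Definition rational_of (R : realType) (a b c : nat) : R :=
  (a%:R - b%:R) / c.+1%:R.

Definition computable_real (R : realType) (x : R) : Prop :=
  exists a b c : 1.-tuple nat -> nat,
    [/\ recursive a, recursive b, recursive c &
      forall n : nat, let v := [tuple n] in
        `|x - rational_of R (a v) (b v) (c v)| <= 2 ^- n].

(* f s is a computable real, uniformly in s. *)
Definition uniformly_computable (R : realType) (f : seq bool -> R) : Prop :=
  exists a b c : 2.-tuple nat -> nat,
    [/\ recursive a, recursive b, recursive c &
      forall (s : seq bool) (n : nat), let v := [tuple string_code s; n] in
        `|f s - rational_of R (a v) (b v) (c v)| <= 2 ^- n].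

(* Cantor space with its Borel sigma-algebra. *)
Notation cantor := (g_sigma_algebraType (@open cantor_space)).

Definition prefix_of (w : cantor) (n : nat) : seq bool := mkseq w n.

Definition cylinder (s : seq bool) : set cantor :=
  [set w | prefix_of w (size s) = s].

(* The sigma-algebra F_n. *)
Definition cylinder_filtration (n : nat) : set (set cantor) :=
  <<s [set cylinder s | s in [set s | size s = n]] >>.

Section measures.
Context {R : realType}.
Implicit Types nu mu : probability cantor R.

Definition mass nu (s : seq bool) : R := fine (nu (cylinder s)).

Definition cond_prob nu (A B : set cantor) : R :=
  fine (nu (A `&` B)) / fine (nu B).

Definition computable_measure nu : Prop := uniformly_computable (mass nu).

Definition full_support nu : Prop := forall s : seq bool, 0 < mass nu s.

Definition Mild nu : set cantor :=
  [set w | (0 < limn_einf (fun n => (cond_prob nu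
      (cylinder (prefix_of w n.+1)) (cylinder (prefix_of w n)))%:E))%E].

Definition dyadic_martingale nu (N : seq bool -> R) : Prop :=
  forall s : seq bool,
    N s = N (rcons s false) * (mass nu (rcons s false) / mass nu s)
        + N (rcons s true) * (mass nu (rcons s true) / mass nu s).

Definition CR nu : set cantor :=
  [set w | forall N : seq bool -> R,
     dyadic_martingale nu N -> uniformly_computable N ->
     (forall s, 0 <= N s) ->
     (ereal_sup (range (fun n => (N (prefix_of w n))%:E)) < +oo)%E].

Definition bdc nu mu : Prop :=
  exists2 r : R, computable_real r &
    (\int[nu]_w ereal_sup (range (fun n =>
       (mass nu (prefix_of w n) / mass mu (prefix_of w n))%:E)) = r%:E)%E.

(* The total variational distance on F between the conditional probabilities
   given the length-n prefix of w. *)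
Definition cond_tv (F : set (set cantor)) nu mu (n : nat) (w : cantor) : R :=
  sup [set `|cond_prob nu A (cylinder (prefix_of w n))
             - cond_prob mu A (cylinder (prefix_of w n))| | A in F].

(* MR_0^nu(rel, F, T), with T the total variational distance. *)
Definition MR0 (rel : probability cantor R -> probability cantor R -> Prop)
    (F : nat -> set (set cantor)) nu : set cantor :=
  [set w | forall mu : probability cantor R,
     computable_measure mu -> full_support mu -> rel nu mu ->
     (fun n => cond_tv (F n) nu mu n w) @ \oo --> (0 : R)].

End measures.

(* Main.v *)
(* Along [w], put [M_n = mu / nu] and [D_n = nu / mu] on the cylinder of the
   length-[n] prefix of [w].  Both stay bounded when [w] is computably random:
   [M] is a computable [nu]-martingale, and [D] is dominated by the martingale
   [E_nu (sup D | F_n)], which is computable because the increasing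
   approximations of its total mass [E_nu (sup D)] converge to a computable
   real, and the same modulus serves for every cylinder.  For the concave
   function [phi x = x / (1 + x)], the compensator of the supermartingale
   [phi M_n] is the sum of the conditional Jensen gaps; adding it to [phi M_n]
   gives a computable nonnegative martingale, so the gaps are summable along
   [w].  As [M_n] stays in a compact subset of [(0, +oo)], each gap controls the
   square of the difference of the two conditional probabilities, which is the
   total variational distance on [F_(n+1)]. *)
Require Import Defs.
From mathcomp Require Import all_boot all_order all_algebra.
From mathcomp Require Import all_classical all_reals all_analysis.
From mathcomp Require Import measurable_realfun ring lra zify.

Set Implicit Arguments.
Unset Strict Implicit.
Unset Printing Implicit Defensive.

Import Order.TTheory GRing.Theory Num.Theory.
Import numFieldNormedType.Exports.

Local Open Scope classical_set_scope.
Local Open Scope ring_scope.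

(** * Total recursive functions of lists of arguments *)

(* Arguments are read off lists with [nth 0], which computes; only lists of
   length [k] matter. *)
Definition seq_recursive (k : nat) (f : seq nat -> nat) : Prop :=
  recursive (fun v : k.-tuple nat => f v).

Lemma eq_seq_recursive (k : nat) (f g : seq nat -> nat) :
  (forall s, size s = k -> f s = g s) -> seq_recursive k f -> seq_recursive k g.
Proof.
move=> fg; rewrite /seq_recursive.
suff -> : (fun v : k.-tuple nat => f v) = (fun v : k.-tuple nat => g v) by [].
by apply/funext => v; rewrite fg// size_tuple.
Qed.

Lemma seq_recursive_nth k i : seq_recursive k (fun s => nth 0%N s i).
Proof.
have [ik|ki] := ltnP i k.
  have := recursive_proj (Ordinal ik); rewrite /seq_recursive.
  suff -> : (fun v : k.-tuple nat => tnth v (Ordinal ik)) =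
            (fun v : k.-tuple nat => nth 0%N v i) by [].
  by apply/funext => v; rewrite (tnth_nth 0%N).
apply: (@eq_seq_recursive _ (fun _ => 0%N)).
  by move=> s sk; rewrite nth_default// sk.
exact: recursive_zero.
Qed.

(** Because [G s] has length [m], the tuple of its entries is [G s] again, so this is
    [recursive_comp]. Composition, permutation and dropping of arguments are all obtained from
    it. *)
Lemma seq_recursive_subst m k (f : seq nat -> nat) (G : seq nat -> seq nat) :
  (forall s, size s = k -> size (G s) = m) ->
  (forall i, (i < m)%N -> seq_recursive k (fun s => nth 0%N (G s) i)) ->
  seq_recursive m f -> seq_recursive k (fun s => f (G s)).
Proof.
move=> sG rG rf.
have := recursive_comp (g := fun (i : 'I_m) (v : k.-tuple nat) => nth 0%N (G v) i)
  rf (fun i => rG i (ltn_ord i)).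
rewrite /seq_recursive.
set F := (X in recursive X -> _); set F' := (X in _ -> recursive X).
suff -> : F = F' by [].
apply/funext => v; rewrite /F /F'; congr (f _).
apply: (@eq_from_nth _ 0%N); first by rewrite size_tuple sG// size_tuple.
move=> i; rewrite size_tuple => im.
by rewrite -[i]/(val (Ordinal im)) -tnth_nth tnth_mktuple.
Qed.

Lemma seq_recursive_weaken k (f : seq nat -> nat) :
  seq_recursive k f -> seq_recursive k.+1 (fun s => f (behead s)).
Proof.
apply: seq_recursive_subst => [s|i ik]; first by rewrite size_behead => ->.
apply: (@eq_seq_recursive _ (fun s => nth 0%N s i.+1)).
  by case=> //= x s; rewrite nth_behead.
exact: seq_recursive_nth.
Qed.

Lemma seq_recursive_cons k (f : seq nat -> nat) (h : seq nat -> nat) :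
  seq_recursive k.+1 f -> seq_recursive k h ->
  seq_recursive k (fun s => f (h s :: s)).
Proof.
move=> rf rh.
apply: (@seq_recursive_subst k.+1 k f (fun s => h s :: s)) rf.
  by move=> s /= ->.
by case=> [|i] _ //=; exact: seq_recursive_nth.
Qed.

Lemma seq_recursive1 k (f : nat -> nat) (h : seq nat -> nat) :
  seq_recursive 1 (fun s => f (nth 0%N s 0)) -> seq_recursive k h ->
  seq_recursive k (fun s => f (h s)).
Proof.
move=> rf rh.
apply: (@seq_recursive_subst 1 k _ (fun s => [:: h s])) rf => //.
by case.
Qed.

Lemma seq_recursiveS k (f : seq nat -> nat) :
  seq_recursive k f -> seq_recursive k (fun s => (f s).+1).
Proof.
apply: seq_recursive1.
have := recursive_succ; rewrite /seq_recursive.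
set F := (X in recursive X -> _); set F' := (X in _ -> recursive X).
suff -> : F = F' by [].
by apply/funext => v; rewrite /F /F' /thead (tnth_nth 0%N).
Qed.

Lemma seq_recursive_const k n : seq_recursive k (fun=> n).
Proof.
elim: n => [|n ih]; first exact: recursive_zero.
exact: seq_recursiveS.
Qed.

(** In [recursive_primrec] the recursion variable is the head of the argument list. Substituting
    [n s] for that head afterwards lets the number of iterations depend on the parameters. *)
Lemma seq_recursive_primrec k (f : seq nat -> nat) (g : nat -> nat -> seq nat -> nat)
    (h : nat -> seq nat -> nat) (n : seq nat -> nat) :
  seq_recursive k f ->
  seq_recursive k.+2 (fun s => g (nth 0%N s 0) (nth 0%N s 1) (drop 2 s)) ->
  (forall s, size s = k -> h 0%N s = f s) ->
  (forall m s, size s = k -> h m.+1 s = g m (h m s) s) ->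
  seq_recursive k n -> seq_recursive k (fun s => h (n s) s).
Proof.
move=> rf rg h0 hS rn.
apply: (@seq_recursive_cons k (fun s => h (head 0%N s) (behead s))) rn.
apply: (recursive_primrec rf rg) => [v|m v] /=.
  by rewrite h0// size_tuple.
by rewrite hS ?size_tuple// drop0.
Qed.

Lemma seq_recursive_drop2 k (f : seq nat -> nat) :
  seq_recursive k f -> seq_recursive k.+2 (fun s => f (drop 2 s)).
Proof.
move=> /seq_recursive_weaken /seq_recursive_weaken.
by apply: eq_seq_recursive => -[|x [|y s]]//= _; rewrite drop0.
Qed.

Lemma seq_recursive_iter k (f : nat -> nat) (a n : seq nat -> nat) :
  seq_recursive 1 (fun s => f (nth 0%N s 0)) ->
  seq_recursive k a -> seq_recursive k n ->
  seq_recursive k (fun s => iter (n s) f (a s)).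
Proof.
move=> rf ra; apply: (@seq_recursive_primrec k a (fun _ x _ => f x)
  (fun n s => iter n f (a s))) => //.
by apply: seq_recursive1 => //; exact: seq_recursive_nth.
Qed.

Lemma seq_recursiveD k (f g : seq nat -> nat) :
  seq_recursive k f -> seq_recursive k g ->
  seq_recursive k (fun s => f s + g s)%N.
Proof.
move=> rf rg; apply: eq_seq_recursive (seq_recursive_iter (f := S) _ rg rf).
  by move=> s _; rewrite iter_succn addnC.
by apply: seq_recursiveS; exact: seq_recursive_nth.
Qed.

Lemma seq_recursive_sum k (F : nat -> seq nat -> nat) (n : seq nat -> nat) :
  seq_recursive k.+1 (fun s => F (nth 0%N s 0) (behead s)) ->
  seq_recursive k n ->
  seq_recursive k (fun s => \sum_(i < n s) F i s)%N.
Proof.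
move=> rF; apply: (@seq_recursive_primrec k (fun=> 0%N)
  (fun m x s => x + F m s)%N (fun n s => \sum_(i < n) F i s)%N).
- exact: seq_recursive_const.
- apply: seq_recursiveD; first exact: seq_recursive_nth.
  apply: (@seq_recursive_subst k.+1 k.+2 _ (fun s => nth 0%N s 0 :: drop 2 s)) rF.
    by move=> s /=; rewrite size_drop => ->; rewrite !subSS subn0.
  move=> [|i] _ /=; first exact: seq_recursive_nth.
  apply: eq_seq_recursive (seq_recursive_nth _ (i.+2)) => s _.
  by rewrite nth_drop.
- by move=> s _; rewrite big_ord0.
- by move=> m s _; rewrite big_ord_recr.
Qed.

Lemma seq_recursiveM k (f g : seq nat -> nat) :
  seq_recursive k f -> seq_recursive k g ->
  seq_recursive k (fun s => f s * g s)%N.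
Proof.
move=> rf rg.
apply: eq_seq_recursive (seq_recursive_sum (F := fun _ s => f s) _ rg).
  by move=> s _; rewrite sum_nat_const card_ord mulnC.
exact: seq_recursive_weaken.
Qed.

Lemma seq_recursive_predn k (f : seq nat -> nat) :
  seq_recursive k f -> seq_recursive k (fun s => (f s).-1).
Proof.
apply: (@seq_recursive_primrec k (fun=> 0%N) (fun m _ _ => m) (fun n _ => n.-1)) => //.
  exact: seq_recursive_const.
exact: seq_recursive_nth.
Qed.

Lemma seq_recursiveB k (f g : seq nat -> nat) :
  seq_recursive k f -> seq_recursive k g ->
  seq_recursive k (fun s => f s - g s)%N.
Proof.
move=> rf rg; apply: eq_seq_recursive (seq_recursive_iter (f := predn) _ rf rg).
  by move=> s _; rewrite iter_predn.
by apply: seq_recursive_predn; exact: seq_recursive_nth.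
Qed.

Lemma seq_recursive_leq k (f g : seq nat -> nat) :
  seq_recursive k f -> seq_recursive k g ->
  seq_recursive k (fun s => (f s <= g s)%N : nat).
Proof.
move=> rf rg.
apply: (@eq_seq_recursive _ (fun s => 1 - (f s - g s))%N).
  by move=> s _; rewrite /leq; case: (f s - g s)%N => [|n]; rewrite ?subn0 ?subSS.
by apply: seq_recursiveB; [exact: seq_recursive_const|exact: seq_recursiveB].
Qed.

Lemma seq_recursive_maxn k (f g : seq nat -> nat) :
  seq_recursive k f -> seq_recursive k g ->
  seq_recursive k (fun s => maxn (f s) (g s)).
Proof.
move=> rf rg; apply: (@eq_seq_recursive _ (fun s => f s + (g s - f s))%N).
  by move=> s _; rewrite maxnE.
by apply: seq_recursiveD => //; exact: seq_recursiveB.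
Qed.

Lemma seq_recursive_bigmax k (F : nat -> seq nat -> nat) (n : seq nat -> nat) :
  seq_recursive k.+1 (fun s => F (nth 0%N s 0) (behead s)) ->
  seq_recursive k n ->
  seq_recursive k (fun s => \max_(i < n s) F i s)%N.
Proof.
move=> rF; apply: (@seq_recursive_primrec k (fun=> 0%N)
  (fun m x s => maxn x (F m s)) (fun n s => \max_(i < n) F i s)%N).
- exact: seq_recursive_const.
- apply: seq_recursive_maxn; first exact: seq_recursive_nth.
  apply: (@seq_recursive_subst k.+1 k.+2 _ (fun s => nth 0%N s 0 :: drop 2 s)) rF.
    by move=> s /=; rewrite size_drop => ->; rewrite !subSS subn0.
  move=> [|i] _ /=; first exact: seq_recursive_nth.
  apply: eq_seq_recursive (seq_recursive_nth _ (i.+2)) => s _.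
  by rewrite nth_drop.
- by move=> s _; rewrite big_ord0.
- by move=> m s _; rewrite big_ord_recr.
Qed.

Lemma seq_recursiveX k (f g : seq nat -> nat) :
  seq_recursive k f -> seq_recursive k g ->
  seq_recursive k (fun s => f s ^ g s)%N.
Proof.
move=> rf; apply: (@seq_recursive_primrec k (fun=> 1%N)
  (fun _ x s => f s * x)%N (fun n s => f s ^ n)%N) => //.
- exact: seq_recursive_const.
- by apply: seq_recursiveM; [exact: seq_recursive_drop2|exact: seq_recursive_nth].
- by move=> m s _; rewrite expnS.
Qed.

(** The test [i.+1 * d <= m] holds exactly for [i < m %/ d], and the quotient is at most [m];
    division thus becomes a bounded count. *)
Lemma divn_sum (m d : nat) : (0 < d)%N ->
  (m %/ d = \sum_(i < m) (i.+1 * d <= m))%N.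
Proof.
move=> d0.
have sum_lt q n : (\sum_(i < n) (i < q) = minn n q)%N.
  elim: n => [|n ih]; first by rewrite big_ord0 min0n.
  by rewrite big_ord_recr/= ih; lia.
rewrite -{1}(minn_idPr (leq_div m d)) -sum_lt.
by apply: eq_bigr => i _; rewrite -leq_divRL.
Qed.

Lemma seq_recursive_divn k (f g : seq nat -> nat) : (forall s, 0 < g s)%N ->
  seq_recursive k f -> seq_recursive k g ->
  seq_recursive k (fun s => f s %/ g s)%N.
Proof.
move=> g0 rf rg.
apply: eq_seq_recursive (seq_recursive_sum (F := fun i s => (i.+1 * g s <= f s)%N) _ rf).
  by move=> s _; rewrite divn_sum.
apply: seq_recursive_leq; last exact: seq_recursive_weaken.
apply: seq_recursiveM; last exact: seq_recursive_weaken.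
by apply: seq_recursiveS; exact: seq_recursive_nth.
Qed.

(** Take the least witness: it is what minimization computes. *)
Lemma seq_recursive_search k (P : nat -> seq nat -> bool) :
  seq_recursive k.+1 (fun s => P (nth 0%N s 0) (behead s) : nat) ->
  (forall s, size s = k -> exists n, P n s) ->
  exists2 h, seq_recursive k h & forall s, size s = k -> P (h s) s.
Proof.
move=> rP exP.
have /choice[h hP] (s : seq nat) : exists m : nat, size s = k ->
    P m s /\ forall n, P n s -> (m <= n)%N.
  (* A list of another length need not have a witness; any value will do there. *)
  have [sk|//] := eqVneq (size s) k; last by exists 0%N => sk; rewrite sk eqxx in i.
  by case: (ex_minnP (exP s sk)) => m Pm mP; exists m.
exists h => [|s sk]; last by have [] := hP s sk.
(* Minimization looks for a zero, so the truth value is flipped. *)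
apply: (@recursive_min k (fun v => 1 - P (nth 0%N v 0) (behead v))%N).
- exact: seq_recursiveB (seq_recursive_const _ _) rP.
- by move=> v /=; have [->] := hP v (size_tuple v).
- move=> v n /= nh; have [_ hm] := hP v (size_tuple v).
  case E : (P n v) => //; by have := hm _ E; rewrite leqNgt nh.
Qed.

(** * Nonnegative computable reals *)

Lemma seq_recursive_app k (F : nat -> seq nat -> nat) (n : seq nat -> nat) :
  seq_recursive k.+1 (fun s => F (nth 0%N s 0) (behead s)) ->
  seq_recursive k n -> seq_recursive k (fun s => F (n s) s).
Proof.
exact: (@seq_recursive_cons k (fun s => F (nth 0%N s 0) (behead s))).
Qed.

Lemma seq_recursive_app_behead k (F : nat -> seq nat -> nat) (n : seq nat -> nat) :
  seq_recursive k.+1 (fun s => F (nth 0%N s 0) (behead s)) ->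
  seq_recursive k.+1 n -> seq_recursive k.+1 (fun s => F (n s) (behead s)).
Proof.
move=> rF rn.
apply: (@seq_recursive_subst k.+1 k.+1 _ (fun s => n s :: behead s)) rF.
  by move=> s /= sk; rewrite size_behead sk.
move=> [|i] _ //=.
apply: eq_seq_recursive (seq_recursive_nth _ i.+1) => s _.
by rewrite nth_behead.
Qed.

Lemma seq_recursive_nth_behead k i : seq_recursive k (fun s => nth 0%N (behead s) i).
Proof.
apply: eq_seq_recursive (seq_recursive_nth k i.+1) => s _.
by rewrite nth_behead.
Qed.

Ltac seq_rec := first
  [ assumption
  | exact: seq_recursive_nth | exact: seq_recursive_nth_behead
  | exact: seq_recursive_const
  | apply: seq_recursiveS; seq_rec
  | apply: seq_recursiveD; seq_rec
  | apply: seq_recursiveM; seq_rec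
  | apply: seq_recursiveB; seq_rec
  | apply: seq_recursiveX; seq_rec
  | apply: seq_recursive_weaken; seq_rec
  | apply: seq_recursive_app_behead; seq_rec
  | apply: seq_recursive_app; seq_rec ].

Lemma exists_expn2_gt (R : realType) (x : R) : exists n, x < 2 ^+ n.
Proof.
exists (Num.bound x); apply: le_lt_trans (ler_norm _) _.
apply: lt_trans (archi_boundP (normr_ge0 x)) _.
rewrite (_ : Num.bound `|x| = Num.bound x); last by rewrite /Num.bound normr_id.
by rewrite -natrX ltr_nat ltn_expl.
Qed.

Lemma expVn2 (R : realType) n m : 2 ^- (n + m) = 2 ^- n / 2 ^+ m :> R.
Proof. by rewrite exprD invfM. Qed.

Lemma bigmax_ord_recr (disp : Order.disp_t) (T : orderType disp) (x : T) n (F : nat -> T) :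
  \big[Order.max/x]_(i < n.+1) F i = Order.max (\big[Order.max/x]_(i < n) F i) (F n).
Proof.
apply/le_anti/andP; split.
  apply/bigmax_leP; split=> [|i _]; first by rewrite le_max bigmax_ge_id.
  rewrite le_max; have [ni|ni] := leqP n i.
    have -> : F n = F i by congr F; have := ltn_ord i; lia.
    by rewrite lexx orbT.
  by rewrite (le_bigmax _ (fun j : 'I_n => F j) (Ordinal ni)).
rewrite ge_max; apply/andP; split.
  apply/bigmax_leP; split=> [|i _]; first exact: bigmax_ge_id.
  exact: (le_bigmax _ (fun j : 'I_n.+1 => F j) (widen_ord (leqnSn n) i)).
exact: (le_bigmax _ (fun j : 'I_n.+1 => F j) ord_max).
Qed.

(* The approximations being natural numbers, such an [f] is nonnegative. *)
Definition creal (R : realType) k (f : seq nat -> R) : Prop :=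
  exists2 a : nat -> seq nat -> nat,
    seq_recursive k.+1 (fun s => a (nth 0%N s 0) (behead s)) &
    forall n s, size s = k -> `|f s * 2 ^+ n - (a n s)%:R| <= 1.

Section creal_closure.
Context {R : realType}.
Implicit Types f g : seq nat -> R.

(** Rounding [2 ^ n * a / d] to a nearest integer, with [a] and [d] taken at precision [n.+1], costs
    at most 1/2. The approximation error, scaled by [2 ^ n], is at most 1/2 as well. *)
Lemma creal_intro k f (a d : nat -> seq nat -> nat) :
  seq_recursive k.+1 (fun s => a (nth 0%N s 0) (behead s)) ->
  seq_recursive k.+1 (fun s => d (nth 0%N s 0) (behead s)) ->
  (forall n s, (0 < d n s)%N) ->
  (forall n s, size s = k ->
     `|f s - (a n s)%:R / (d n s)%:R| <= 2 ^- n) ->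
  creal k f.
Proof.
move=> ra rd d0 fad.
exists (fun n s => (2 ^ n.+1 * a n.+1 s + d n.+1 s) %/ (2 * d n.+1 s))%N.
  apply: seq_recursive_divn => [s| |].
  - by rewrite muln_gt0 d0.
  - by apply: seq_recursiveD;
      [apply: seq_recursiveM; seq_rec|apply: seq_recursive_app_behead; seq_rec].
  - by apply: seq_recursiveM; seq_rec.
move=> n s sk; have := fad n.+1 s sk; have := d0 n.+1 s.
move: (a _ _) (d _ _) => A D D0 fad'.
set q := (_ %/ _)%N.
have q1 : (q * (2 * D) <= 2 ^ n.+1 * A + D)%N by rewrite leq_trunc_div.
have q2 : (2 ^ n.+1 * A + D < q.+1 * (2 * D))%N by rewrite ltn_ceil// muln_gt0.
have pd : 0 < D%:R :> R by rewrite ltr0n.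
move: q1 q2; rewrite -(ler_nat R) -(ltr_nat R) !natrM !natrD !natrM natrX -(natr1 q) exprSr.
move: fad'; rewrite exprSr invfM !ler_norml.
have := exprn_gt0 n (ltr0Sn R 1).
move: (2 ^+ n) => e e0 /andP[h1 h2] q1 q2.
have -> : f s = (f s - A%:R / D%:R) + A%:R / D%:R by rewrite subrK.
move: (f s - _) h1 h2 => x h1 h2.
have h3 : - 2^-1 <= x * e.
  by rewrite -ler_pdivrMr// mulNr mulrC.
have h4 : x * e <= 2^-1.
  by rewrite -ler_pdivlMr// mulrC.
have h5 : `|A%:R / D%:R * e - q%:R| <= 2^-1.
  have -> : A%:R / D%:R * e - q%:R = (A%:R * e - q%:R * D%:R) / D%:R.
    by rewrite mulrBl mulfK ?gt_eqF//; ring.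
  rewrite normrM [X in _ * X]gtr0_norm ?invr_gt0//.
  by rewrite ler_pdivrMr// ler_norml; apply/andP; split; lra.
move: h5; rewrite ler_norml => /andP[h5 h6].
by rewrite mulrDl; apply/andP; split; lra.
Qed.

Lemma creal_approx k f : creal k f ->
  exists2 a : nat -> seq nat -> nat,
    seq_recursive k.+1 (fun s => a (nth 0%N s 0) (behead s)) &
    forall n s, size s = k -> `|f s - (a n s)%:R / (2 ^ n)%:R| <= 2 ^- n.
Proof.
move=> [a ra fa]; exists a => // n s sk.
have e0 : 0 < 2 ^+ n :> R by rewrite exprn_gt0.
have -> : f s - (a n s)%:R / (2 ^ n)%:R = (f s * 2 ^+ n - (a n s)%:R) / 2 ^+ n.
  by rewrite natrX; field; rewrite gt_eqF.
rewrite normrM [X in _ * X]gtr0_norm ?invr_gt0//.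
by rewrite ler_piMl ?invr_ge0 ?(ltW e0)// fa.
Qed.

Lemma eq_creal k f g : (forall s, size s = k -> f s = g s) -> creal k f -> creal k g.
Proof. by move=> fg [a ra fa]; exists a => // n s sk; rewrite -fg// fa. Qed.

Lemma creal_subst m k f (G : seq nat -> seq nat) :
  (forall s, size s = k -> size (G s) = m) ->
  (forall i, (i < m)%N -> seq_recursive k (fun s => nth 0%N (G s) i)) ->
  creal m f -> creal k (fun s => f (G s)).
Proof.
move=> sG rG [a ra fa]; exists (fun n s => a n (G s)); last first.
  by move=> n s sk; rewrite fa// sG.
apply: (@seq_recursive_subst m.+1 k.+1 _ (fun s => nth 0%N s 0 :: G (behead s))) ra.
  by move=> s sk /=; rewrite sG// size_behead sk.
move=> [|i] im /=; first exact: seq_recursive_nth.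
exact: seq_recursive_weaken (rG i im).
Qed.

Lemma creal1 k (f : nat -> R) (g : seq nat -> nat) :
  creal 1 (fun s => f (nth 0%N s 0)) -> seq_recursive k g ->
  creal k (fun s => f (g s)).
Proof.
move=> cf rg; apply: (@creal_subst 1 k _ (fun s => [:: g s])) cf => //.
by case.
Qed.

Lemma creal2 k (f : nat -> nat -> R) (g h : seq nat -> nat) :
  creal 2 (fun s => f (nth 0%N s 0) (nth 0%N s 1)) ->
  seq_recursive k g -> seq_recursive k h ->
  creal k (fun s => f (g s) (h s)).
Proof.
move=> cf rg rh; apply: (@creal_subst 2 k _ (fun s => [:: g s; h s])) cf => //.
by do 2![case=> //].
Qed.

Lemma crealD k f g : creal k f -> creal k g -> creal k (fun s => f s + g s).
Proof.
move=> /creal_approx[a ra fa] /creal_approx[b rb gb].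
apply: (@creal_intro k _ (fun n s => a n.+1 s + b n.+1 s)%N (fun n s => 2 ^ n.+1)%N).
- by apply: seq_recursiveD; apply: seq_recursive_app_behead; seq_rec.
- by seq_rec.
- by move=> n s; rewrite expn_gt0.
move=> n s sk; have := fa n.+1 s sk; have := gb n.+1 s sk.
rewrite natrD (mulrDl (a n.+1 s)%:R).
move: (_ / _) => u; move: (_ / _) => v; rewrite exprSr invfM.
by rewrite !ler_norml => /andP[? ?] /andP[? ?]; apply/andP; split; lra.
Qed.

Lemma crealB k f g : (forall s, size s = k -> g s <= f s) ->
  creal k f -> creal k g -> creal k (fun s => f s - g s).
Proof.
move=> gf /creal_approx[a ra fa] /creal_approx[b rb gb].
apply: (@creal_intro k _ (fun n s => a n.+1 s - b n.+1 s)%N (fun n s => 2 ^ n.+1)%N).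
- by apply: seq_recursiveB; apply: seq_recursive_app_behead; seq_rec.
- by seq_rec.
- by move=> n s; rewrite expn_gt0.
move=> n s sk; have := fa n.+1 s sk; have := gb n.+1 s sk; have := gf s sk.
have [ba|ab] := leqP (b n.+1 s) (a n.+1 s).
  rewrite natrB// (mulrBl _ (a n.+1 s)%:R).
  move: (_ / _) => u; move: (_ / _) => v; rewrite exprSr invfM.
  by rewrite !ler_norml => ? /andP[? ?] /andP[? ?]; apply/andP; split; lra.
(* Here the subtraction is truncated. As [g s <= f s], the true difference then lies between 0 and
   the sum of the two errors. *)
have -> : (a n.+1 s - b n.+1 s = 0)%N by lia.
have : (a n.+1 s)%:R / (2 ^ n.+1)%:R <= (b n.+1 s)%:R / (2 ^ n.+1)%:R :> R.
  by rewrite ler_wpM2r ?invr_ge0// ler_nat ltnW.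
move: (_ / _) => u; move: (_ / _) => v; rewrite exprSr invfM mul0r subr0.
by rewrite !ler_norml => ? ? /andP[? ?] /andP[? ?]; apply/andP; split; lra.
Qed.

Lemma crealM k f g : creal k f -> creal k g -> creal k (fun s => f s * g s).
Proof.
move=> /creal_approx[a ra fa] /creal_approx[b rb gb].
(* Let [A] and [B] be the approximations at precision 0, so [f s] is at most [A + 1] in absolute
   value, and the finer approximation of [g s] at most [B + 2]. With errors at most [t], the product
   is off by at most [(A + B + 3) * t], and [A + B + 3] is below [2 ^ (A + B + 3)]. *)
pose N n s := (n + (a 0%N s + b 0%N s + 3))%N.
have rN : seq_recursive k.+1 (fun s => N (nth 0%N s 0) (behead s)).
  apply: seq_recursiveD; first by seq_rec.
  by apply: seq_recursiveD; last seq_rec; apply: seq_recursiveD;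
    apply: seq_recursive_app_behead; seq_rec.
apply: (@creal_intro k _ (fun n s => a (N n s) s * b (N n s) s)%N
  (fun n s => 2 ^ N n s * 2 ^ N n s)%N).
- by apply: seq_recursiveM; apply: seq_recursive_app_behead.
- by apply: seq_recursiveM; apply: seq_recursiveX => //; seq_rec.
- by move=> n s; rewrite muln_gt0 !expn_gt0.
move=> n s sk; have := fa 0%N s sk; have := gb 0%N s sk.
have := fa (N n s) s sk; have := gb (N n s) s sk.
rewrite !natrM invfM mulrACA expn0 expr0 invr1 !mulr1.
rewrite /N expVn2.
set c := (_ + _ + 3)%N.
have : (a 0%N s)%:R + (b 0%N s)%:R + 3 <= 2 ^+ c :> R.
  by rewrite -!natrD -natrX ler_nat ltnW// ltn_expl.
have : 0 < 2 ^+ c :> R by rewrite exprn_gt0.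
set e := 2 ^- n.
have e1 : e <= 1 by rewrite /e invf_le1 ?exprn_ege1 ?exprn_gt0// ler1n.
clearbody e.
have : 0 <= (a 0%N s)%:R :> R by [].
have : 0 <= (b 0%N s)%:R :> R by [].
move: (a 0%N s)%:R => A; move: (b 0%N s)%:R => B.
move: (2 ^+ c) => C.
move: ((a _ s)%:R / _) => u; move: ((b _ s)%:R / _) => v.
move: (f s) (g s) => x y B0 A0 C0 hC yv xu yB xA.
have eE : e = e / C * C by rewrite divfK// gt_eqF.
move: (e / C) eE yv xu => t eE yv xu.
have t0 : 0 <= t by exact: le_trans (normr_ge0 _) yv.
have t1 : t <= 1 by apply: le_trans e1; rewrite eE ler_peMr//; lra.
have -> : x * y - u * v = x * (y - v) + v * (x - u) by ring.
have xA1 : `|x| <= A + 1.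
  by have := ler_normB (x - A) (- A); rewrite opprK subrK normrN (ger0_norm A0) => ?; lra.
have yB1 : `|y| <= B + 1.
  by have := ler_normB (y - B) (- B); rewrite opprK subrK normrN (ger0_norm B0) => ?; lra.
have vB1 : `|v| <= B + 2 by have := ler_normB y (y - v); rewrite opprB addrC subrK => ?; lra.
apply: le_trans (ler_normD _ _) _; rewrite !normrM.
have := ler_pM (normr_ge0 _) (normr_ge0 _) xA1 yv.
have := ler_pM (normr_ge0 _) (normr_ge0 _) vB1 xu.
have : t * (A + B + 3) <= t * C by rewrite ler_wpM2l.
by rewrite -eE => ? ? ?; lra.
Qed.

(** A positive lower bound for [f s] is found by search: an approximation of [f s * 2 ^ m] that is
    at least 2 certifies [2 ^- m <= f s]. *)
Lemma creal_inv k f : (forall s, size s = k -> 0 < f s) ->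
  creal k f -> creal k (fun s => (f s)^-1).
Proof.
move=> f0 [a ra fa].
have [|s sk|m rm mP] := @seq_recursive_search k (fun n s => 2 <= a n s)%N.
- by apply: seq_recursive_leq => //; seq_rec.
- have [n] := exists_expn2_gt (3 / f s); rewrite ltr_pdivrMr ?f0// mulrC => fn.
  exists n; have := fa n s sk; rewrite ler_norml => /andP[_ fan].
  by rewrite -ltnS -(ltr_nat R); move: fan fn; rewrite -natr1; lra.
(* Inverting divides the error by about the square of [f s], which the search bounds below by
   [2 ^- m] squared; hence twice [m s], with one spare bit for each factor. *)
pose N n s := (n + (m s).+1.*2)%N.
have rN : seq_recursive k.+1 (fun s => N (nth 0%N s 0) (behead s)).
  apply: eq_seq_recursive (_ : seq_recursive _
    (fun s => nth 0%N s 0 + ((m (behead s)).+1 * 2))%N).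
    by move=> s _; rewrite /N -muln2.
  by apply: seq_recursiveD; first seq_rec; apply: seq_recursiveM; seq_rec.
(* The maximum with 1 keeps the denominator positive on all lists; on lists of length [k] it changes
   nothing, by [c1] below. *)
apply: (@creal_intro k _ (fun n s => 2 ^ N n s)%N (fun n s => maxn 1 (a (N n s) s))%N).
- by apply: seq_recursiveX => //; seq_rec.
- by apply: seq_recursive_maxn; [seq_rec|apply: seq_recursive_app_behead].
- by move=> n s; rewrite leq_max.
move=> n s sk; have := fa (N n s) s sk; have := fa (m s) s sk; have := mP s sk.
have := f0 s sk.
rewrite -(ler_nat R) natrX.
have -> : 2 ^+ N n s = 2 ^+ n * (2 ^+ m s * 2) ^+ 2 :> R.
  by rewrite /N -muln2 exprD exprM (exprSr _ (m s)).
move: (a (m s) s) (a (N n s) s) (f s) => b c x x0 b2.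
have : 1 <= 2 ^+ m s :> R by rewrite exprn_ege1 ?ler1n.
have : 1 <= 2 ^+ n :> R by rewrite exprn_ege1 ?ler1n.
move: (2 ^+ m s) (2 ^+ n) => M E E1 M0; rewrite ler_norml => /andP[h1 _] h2.
have xM : 1 <= x * M by lra.
have xM2 : 1 <= (x * M) * (x * M) by rewrite -[1]mulr1 ler_pM.
move: h2; set W := E * (M * 2) ^+ 2 => h2.
have WE : W = E * (M * 2) ^+ 2 by [].
clearbody W.
have EM : 1 <= E * M by rewrite -[1]mulr1 ler_pM.
have xW : 4 <= x * W.
  have : 1 <= (E * M) * (x * M) by rewrite -[1]mulr1 ler_pM.
  have -> : x * W = 4 * ((E * M) * (x * M)) by rewrite WE; ring.
  by move=> ?; lra.
have cW : x * W <= 2 * c%:R.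
  by move: h2; rewrite ler_norml => /andP[_ ?]; lra.
have c1 : (1 <= c)%N by rewrite -(ler_nat R) /=; lra.
have c0 : 0 < c%:R :> R by rewrite ltr0n.
rewrite (maxn_idPr c1).
have -> : x^-1 - W / c%:R = (c%:R - x * W) / (x * c%:R).
  by field; rewrite (gt_eqF x0) (gt_eqF c0).
have E0 : 0 < E by lra.
have Exc : E <= x * c%:R.
  apply: (@le_trans _ _ (x * (x * W / 2))); last by rewrite ler_pM2l//; lra.
  have -> : x * (x * W / 2) = E * (2 * ((x * M) * (x * M))) by rewrite WE; field.
  by rewrite ler_peMr//; lra.
rewrite normrM distrC normfV [X in _ / X]gtr0_norm ?mulr_gt0//.
rewrite ler_pdivrMr ?mulr_gt0//; apply: le_trans h2 _.
by rewrite mulrC ler_pdivlMr// mul1r.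
Qed.

Lemma creal_sum k (F : nat -> seq nat -> R) (B : seq nat -> nat) :
  creal k.+1 (fun s => F (nth 0%N s 0) (behead s)) -> seq_recursive k B ->
  creal k (fun s => \sum_(i < B s) F i s).
Proof.
move=> /creal_approx[a ra fa] rB.
have rN : seq_recursive k.+1 (fun s => nth 0%N s 0 + B (behead s))%N by seq_rec.
(* There are [B s] errors of at most [2 ^- (n + B s)] each, and [B s <= 2 ^ B s]. *)
apply: (@creal_intro k (fun s => \sum_(i < B s) F i s)
  (fun n s => \sum_(i < B s) a (n + B s) ((i : nat) :: s))%N
  (fun n s => 2 ^ (n + B s))%N).
- apply: (seq_recursive_sum
    (F := fun i s => a (nth 0%N s 0 + B (behead s)) (i :: behead s))%N); last by seq_rec.
  apply: (@seq_recursive_subst k.+2 k.+2 _ (fun s =>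
    (nth 0%N (behead s) 0 + B (behead (behead s)))%N :: nth 0%N s 0 :: behead (behead s))) ra.
    by move=> s /= sk; rewrite !size_behead sk.
  move=> [|[|i]] _ /=; [exact: seq_recursive_weaken rN|exact: seq_recursive_nth|].
  apply: eq_seq_recursive (seq_recursive_nth _ i.+2) => s _.
  by rewrite !nth_behead.
- by seq_rec.
- by move=> n s; rewrite expn_gt0.
move=> n s sk; rewrite natr_sum mulr_suml -sumrB.
apply: le_trans (ler_norm_sum _ _ _) _.
apply: (@le_trans _ _ (\sum_(i < B s) 2 ^- (n + B s))).
  by apply: ler_sum => i _; apply: (fa (n + B s)%N (val i :: s)) => /=; rewrite sk.
rewrite sumr_const card_ord expVn2 -(mulr_natr (_ / _)) -mulrA ler_piMr ?invr_ge0 ?exprn_ge0//.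
by rewrite mulrC ler_pdivrMr ?exprn_gt0// mul1r -natrX ler_nat ltnW// ltn_expl.
Qed.

(** Taking a maximum does not enlarge the largest error, so the maximum of the approximations serves
    at the same precision. *)
Lemma creal_bigmax k (F : nat -> seq nat -> R) (B : seq nat -> nat) :
  creal k.+1 (fun s => F (nth 0%N s 0) (behead s)) -> seq_recursive k B ->
  creal k (fun s => \big[Num.max/0]_(i < B s) F i s).
Proof.
move=> [a ra fa] rB.
exists (fun n s => \max_(i < B s) a n ((i : nat) :: s))%N.
  apply: (seq_recursive_bigmax
    (F := fun i s => a (nth 0%N s 0) (i :: behead s))%N); last by seq_rec.
  apply: (@seq_recursive_subst k.+2 k.+2 _ (fun s =>
    nth 0%N (behead s) 0 :: nth 0%N s 0 :: behead (behead s))) ra.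
    by move=> s /= sk; rewrite !size_behead sk.
  move=> [|[|i]] _ /=; [|exact: seq_recursive_nth|].
    by apply: eq_seq_recursive (seq_recursive_nth _ 1%N) => s _; rewrite nth_behead.
  apply: eq_seq_recursive (seq_recursive_nth _ i.+2) => s _.
  by rewrite !nth_behead.
move=> n s sk; elim: (B s) => [|b ih].
  by rewrite !big_ord0 mul0r subrr normr0.
rewrite (bigmax_ord_recr _ _ (F^~ s)) big_ord_recr/=.
have := fa n (b :: s); rewrite /= sk => /(_ erefl).
move: ih; set x := \big[_/_]_(_ < _) _; set y := (\max_(_ < _) _)%N.
move: (F b s) (a n (b :: s)) x y => u c x y; rewrite !ler_norml => /andP[h1 h2] /andP[h3 h4].
have e0 : 0 <= 2 ^+ n :> R by rewrite exprn_ge0.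
have [yc|/ltnW cy] := leqP y c; have [xu|/ltW ux] := leP x u.
- by apply/andP; split.
- have := ler_wpM2r e0 ux; have : y%:R <= c%:R :> R by rewrite ler_nat.
  by move=> ? ?; apply/andP; split; lra.
- have := ler_wpM2r e0 xu; have : c%:R <= y%:R :> R by rewrite ler_nat.
  by move=> ? ?; apply/andP; split; lra.
- by apply/andP; split.
Qed.

Lemma creal_lim k (F : nat -> seq nat -> R) f :
  creal k.+1 (fun s => F (nth 0%N s 0) (behead s)) ->
  (forall n s, size s = k -> `|f s - F n s| <= 2 ^- n) -> creal k f.
Proof.
move=> /creal_approx[a ra fa] fF.
(* Half of the allowed error goes to the index of the sequence, half to the approximation of its
   term. *)
apply: (@creal_intro k _ (fun n s => a n.+1 (n.+1 :: s)) (fun n s => 2 ^ n.+1)%N).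
- apply: (@seq_recursive_subst k.+2 k.+1 _ (fun s =>
    (nth 0%N s 0).+1 :: (nth 0%N s 0).+1 :: behead s)) ra.
    by move=> s /= sk; rewrite !size_behead sk.
  move=> [|[|i]] _ /=; [by seq_rec|by seq_rec|].
  apply: eq_seq_recursive (seq_recursive_nth _ i.+1) => s _.
  by rewrite !nth_behead.
- by seq_rec.
- by move=> n s; rewrite expn_gt0.
move=> n s sk; have := fF n.+1 s sk.
have := fa n.+1 (n.+1 :: s); rewrite /= sk => /(_ erefl).
move: (_ / _) => u; rewrite exprSr invfM.
by rewrite !ler_norml => /andP[? ?] /andP[? ?]; apply/andP; split; lra.
Qed.
End creal_closure.

(** * Codes of binary strings *)

Lemma string_code_rcons s b : string_code (rcons s b) = ((string_code s).*2.+1 + b)%N.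
Proof. by rewrite /string_code foldl_rcons. Qed.

Lemma string_code_surj c : exists s, string_code s = c.
Proof.
elim/ltn_ind: c => -[|c] ih; first by exists [::].
have [|s sc] := ih c./2; first by lia.
exists (rcons s (odd c)); rewrite string_code_rcons sc.
by have := odd_double_half c; lia.
Qed.

Lemma string_code_inj : injective string_code.
Proof.
elim/last_ind => [|s b ih] t; case/lastP: t => [|t c] //; rewrite !string_code_rcons//.
move=> h; have bc : b = c by case: b c h => -[]//; lia.
by rewrite bc (ih t)//; move: h; rewrite bc; lia.
Qed.

Definition string_of_code (c : nat) : seq bool := sval (cid (string_code_surj c)).

Lemma string_of_codeK : cancel string_of_code string_code.
Proof. by move=> c; rewrite /string_of_code; case: cid. Qed.

Lemma string_codeK : cancel string_code string_of_code.
Proof. exact: inj_can_sym string_of_codeK string_code_inj. Qed.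

(** The code plus one, in binary, has one digit more than the string. *)
Lemma string_code_bounds s : (2 ^ size s <= (string_code s).+1 < 2 ^ (size s).+1)%N.
Proof.
elim/last_ind: s => [|s b] //.
by rewrite string_code_rcons size_rcons !expnS; case: b; lia.
Qed.

(** Counting the powers of two below the code plus one exhibits the length as a bounded sum, hence
    as a recursive function of the code. *)
Lemma size_string_code s :
  size s = (\sum_(j < string_code s) (2 ^ j.+1 <= (string_code s).+1))%N.
Proof.
have /andP[s1 s2] := string_code_bounds s.
have ss : (size s <= string_code s)%N.
  by rewrite -ltnS (leq_trans _ s1)// ltn_expl.
transitivity (\sum_(j < string_code s) (j < size s))%N.
  elim: (string_code s) (size s) ss {s1 s2} => [|n ih] m mn.
    by rewrite big_ord0; lia.
  have [mn'|nm] := leqP m n; rewrite big_ord_recr/=.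
    by rewrite ltnNge mn' addn0; exact: ih.
  have -> : m = n.+1 by lia.
  rewrite ltnSn addn1 (eq_bigr (fun=> 1%N)) ?sum1_card ?card_ord// => i _.
  by rewrite ltnS ltnW.
apply: eq_bigr => j _; congr (nat_of_bool _); apply/idP/idP => js.
  by apply: leq_trans s1; rewrite leq_exp2l.
by rewrite -ltnS -(ltn_exp2l (m := 2))// (leq_ltn_trans js s2).
Qed.

(** Dropping the last digits of the code plus one is division by a power of two. If [n] exceeds the
    length, the exponent truncates to 0 and nothing is dropped. *)
Lemma string_code_take n s :
  string_code (take n s) = ((string_code s).+1 %/ 2 ^ (size s - n)).-1.
Proof.
elim/last_ind: s => [|s b ih] //; rewrite size_rcons string_code_rcons.
have [sn|ns] := ltnP (size s) n.
  rewrite take_oversize ?size_rcons// (_ : (_ - _ = 0)%N) ?divn1 ?string_code_rcons//.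
  by lia.
rewrite subSn// expnS divnMA -cats1 takel_cat//.
by rewrite (_ : (_ %/ 2 = (string_code s).+1)%N)//; case: b; lia.
Qed.

Lemma seq_recursive_size_code k (c : seq nat -> nat) : seq_recursive k c ->
  seq_recursive k (fun s => size (string_of_code (c s))).
Proof.
apply: (@seq_recursive1 k (fun c => size (string_of_code c))).
apply: (@eq_seq_recursive _ (fun s => \sum_(j < nth 0 s 0) (2 ^ j.+1 <= (nth 0 s 0).+1))%N).
  by move=> s _; rewrite size_string_code string_of_codeK.
apply: (seq_recursive_sum (F := fun j s => (2 ^ j.+1 <= (nth 0 s 0).+1)%N)); last by seq_rec.
by apply: seq_recursive_leq; seq_rec.
Qed.

Section string_computable.
Context {R : realType}.

Definition string_creal (f : seq bool -> R) : Prop :=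
  creal 1 (fun v => f (string_of_code (nth 0%N v 0))).

Lemma string_creal_app k f (c : seq nat -> nat) :
  string_creal f -> seq_recursive k c -> creal k (fun v => f (string_of_code (c v))).
Proof. exact: (creal1 (f := fun c => f (string_of_code c))). Qed.

Lemma string_creal_rcons f b : string_creal f -> string_creal (fun s => f (rcons s b)).
Proof.
move=> cf; apply: eq_creal (string_creal_app (c := fun v => (nth 0 v 0 * 2 + b).+1)%N cf _).
  move=> v _; congr f; apply: string_code_inj.
  by rewrite string_code_rcons !string_of_codeK; lia.
by seq_rec.
Qed.

Lemma string_creal_take k f (n c : seq nat -> nat) :
  string_creal f -> seq_recursive k n -> seq_recursive k c ->
  creal k (fun v => f (take (n v) (string_of_code (c v)))).
Proof.
move=> cf rn rc; apply: (@eq_creal _ _ (fun v => f (string_of_code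
  ((c v).+1 %/ 2 ^ (size (string_of_code (c v)) - n v)).-1))).
  move=> v _; congr f; apply: string_code_inj.
  by rewrite string_of_codeK string_code_take string_of_codeK.
apply: string_creal_app => //; apply: seq_recursive_predn; apply: seq_recursive_divn.
- by move=> v; rewrite expn_gt0.
- by seq_rec.
- apply: seq_recursiveX; first by seq_rec.
  by apply: seq_recursiveB => //; exact: seq_recursive_size_code.
Qed.

Lemma string_creal_sum_take f :
  string_creal f -> string_creal (fun s => \sum_(n < size s) f (take n s)).
Proof.
move=> cf; apply: (creal_sum (F := fun n v => f (take n (string_of_code (nth 0%N v 0))))).
  by apply: string_creal_take => //; seq_rec.
by apply: seq_recursive_size_code; seq_rec.
Qed.

Lemma string_creal_bigmax_take f : string_creal f ->
  string_creal (fun s => \big[Num.max/0]_(n < (size s).+1) f (take n s)).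
Proof.
move=> cf; apply: (creal_bigmax (F := fun n v => f (take n (string_of_code (nth 0%N v 0))))).
  by apply: string_creal_take => //; seq_rec.
by apply: seq_recursiveS; apply: seq_recursive_size_code; seq_rec.
Qed.

(** For [f] of the form [mass nu * g] this is the integral over [cylinder s] of [g] at prefixes of
    length [size s + j]. The recursion splits at the first added bit, so additivity over the two
    children holds by computation. *)
Fixpoint extension_sum (f : seq bool -> R) (j : nat) (s : seq bool) : R :=
  if j is i.+1 then extension_sum f i (rcons s false) + extension_sum f i (rcons s true)
  else f s.

(* Prefixing the binary expansion of a code plus one with the digits of the
   string, [code + 1] reads "1" followed by the string. *)
Lemma extension_sum_codes f j s : extension_sum f j s =
  \sum_(i < 2 ^ j) f (string_of_code ((string_code s).+1 * 2 ^ j + i).-1).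
Proof.
elim: j s => [|j ih] s /=.
  by rewrite big_ord1 muln1 addn0 string_codeK.
rewrite !ih !string_code_rcons addn0 addn1 expnS mul2n -(addnn (2 ^ j)) big_split_ord/=.
by congr (_ + _); apply: eq_bigr => i _; do 3!congr (_ _); lia.
Qed.

Lemma creal_extension_sum f : string_creal f ->
  creal 2 (fun v => extension_sum f (nth 0%N v 0) (string_of_code (nth 0%N v 1))).
Proof.
move=> cf; apply: (@eq_creal _ _ (fun v => \sum_(i < 2 ^ nth 0%N v 0) f (string_of_code
    ((nth 0%N v 1).+1 * 2 ^ nth 0%N v 0 + i).-1))).
  by move=> v _; rewrite extension_sum_codes string_of_codeK.
apply: (creal_sum (F := fun i v => f (string_of_code
    ((nth 0%N v 1).+1 * 2 ^ nth 0%N v 0 + i).-1))); last by seq_rec.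
by apply: string_creal_app => //; apply: seq_recursive_predn; seq_rec.
Qed.

(** Truncated subtraction replaces a negative approximation by 0, which is closer to a nonnegative
    [x]. *)
Lemma rational_of_subn_le (x : R) (a b c : nat) : 0 <= x ->
  `|x - (a - b)%N%:R / c.+1%:R| <= `|x - rational_of R a b c|.
Proof.
rewrite /rational_of => x0.
have [ba|/ltnW ab] := leqP b a; first by rewrite natrB.
have -> : (a - b = 0)%N by lia.
rewrite mul0r subr0.
have : (a%:R - b%:R) / c.+1%:R <= 0 :> R by rewrite mulr_le0_ge0// subr_le0 ler_nat.
by move: (_ / _) => q q0; rewrite !ger0_norm//; lra.
Qed.

Lemma uniformly_computable_creal f : (forall s, 0 <= f s) ->
  uniformly_computable f -> string_creal f.
Proof.
move=> f0 [a [b [c [ra rb rc fabc]]]].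
(* [creal] expects the precision first, [uniformly_computable] the code of the string. *)
pose fromt (h : 2.-tuple nat -> nat) (n : nat) (v : seq nat) :=
  h [tuple nth 0%N v 0; n].
have rfromt h : recursive h -> seq_recursive 2
    (fun v => fromt h (nth 0%N v 0) (behead v)).
  move=> rh; apply: (@seq_recursive_subst 2 2
     (fun v => h [tuple nth 0%N v 0; nth 0%N v 1])
     (fun v => [:: nth 0%N (behead v) 0; nth 0%N v 0])) => //.
    by move=> [|[|i]] _; seq_rec.
  rewrite /seq_recursive; set F := (X in recursive X).
  suff -> : F = h by [].
  apply/funext => v; rewrite /F; congr h; apply: eq_from_tnth => i.
  by rewrite !(tnth_nth 0%N); case: i => -[|[|]].
apply: (@creal_intro R 1 _ (fun n v => fromt a n v - fromt b n v)%N
  (fun n v => (fromt c n v).+1)).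
- by apply: seq_recursiveB; exact: rfromt.
- by apply: seq_recursiveS; exact: rfromt.
- by [].
move=> n v _; have := fabc (string_of_code (nth 0%N v 0)) n.
rewrite string_of_codeK; apply: le_trans.
exact: rational_of_subn_le.
Qed.

Lemma creal_uniformly_computable f : string_creal f -> uniformly_computable f.
Proof.
move=> /creal_approx[a ra fa].
have rec2 (h : seq nat -> nat) : seq_recursive 2 h ->
    recursive (fun v : 2.-tuple nat => h v) by [].
(* [rational_of] divides by the successor of its last argument, hence the predecessor of [2 ^ n]. *)
exists (fun v => a (nth 0%N v 1) [:: nth 0%N v 0]), (fun=> 0%N),
  (fun v => (2 ^ nth 0%N v 1).-1); split.
- apply: (rec2 (fun v => a (nth 0%N v 1) [:: nth 0%N v 0])).
  apply: (@seq_recursive_subst 2 2 _ (fun v => [:: nth 0%N v 1; nth 0%N v 0])) ra => //.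
  by move=> [|[|i]] _; seq_rec.
- exact: recursive_zero.
- apply: (rec2 (fun v => (2 ^ nth 0%N v 1).-1)).
  by apply: seq_recursive_predn; seq_rec.
move=> s n /=; rewrite /rational_of subr0 prednK ?expn_gt0//.
by have := fa n [:: string_code s]; rewrite /= string_codeK; exact.
Qed.

Lemma computable_real_creal (x : R) : 0 <= x -> computable_real x -> creal 0 (fun=> x).
Proof.
move=> x0 [a [b [c [ra rb rc xabc]]]].
pose fromt (h : 1.-tuple nat -> nat) (n : nat) (v : seq nat) := h [tuple n].
have rfromt h : recursive h -> seq_recursive 1
    (fun v => fromt h (nth 0%N v 0) (behead v)).
  rewrite /seq_recursive; set F := (X in _ -> recursive X).
  suff -> : F = h by [].
  apply/funext => v; rewrite /F; congr h; apply: eq_from_tnth => i.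
  by rewrite !(tnth_nth 0%N); case: i => -[|].
apply: (@creal_intro R 0 _ (fun n v => fromt a n v - fromt b n v)%N
  (fun n v => (fromt c n v).+1)).
- by apply: seq_recursiveB; exact: rfromt.
- by apply: seq_recursiveS; exact: rfromt.
- by [].
by move=> n v _; apply: le_trans (rational_of_subn_le _ _ _ x0) (xabc n).
Qed.
End string_computable.

(** * Cylinders and masses *)

Lemma prefix_ofS (w : cantor) n : prefix_of w n.+1 = rcons (prefix_of w n) (w n).
Proof. exact: mkseqS. Qed.

Lemma size_prefix_of (w : cantor) n : size (prefix_of w n) = n.
Proof. exact: size_mkseq. Qed.

Lemma take_prefix_of (w : cantor) m n : (m <= n)%N ->
  take m (prefix_of w n) = prefix_of w m.
Proof. by move=> mn; rewrite /prefix_of /mkseq -map_take take_iota (minn_idPl mn). Qed.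

Lemma cylinder_nil : cylinder [::] = setT.
Proof. by apply/seteqP; split. Qed.

Lemma mem_cylinder_rcons s b (w : cantor) :
  cylinder (rcons s b) w <-> cylinder s w /\ w (size s) = b.
Proof.
rewrite /cylinder/= size_rcons prefix_ofS; split=> [/rcons_inj[-> ->]//|[-> ->]//].
Qed.

Lemma cylinder_split s :
  cylinder s = cylinder (rcons s false) `|` cylinder (rcons s true).
Proof.
apply/seteqP; split=> w.
  move=> sw; case E : (w (size s)); [right|left]; exact/mem_cylinder_rcons.
by case=> /mem_cylinder_rcons[].
Qed.

Lemma cylinder_split_disjoint s :
  cylinder (rcons s false) `&` cylinder (rcons s true) = set0.
Proof.
apply/seteqP; split=> w // [/mem_cylinder_rcons[_ w0] /mem_cylinder_rcons[_]].
by rewrite w0.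
Qed.

Lemma open_cylinder s : @open cantor_space (cylinder s).
Proof.
elim/last_ind: s => [|s b ih]; first by rewrite cylinder_nil; exact: openT.
rewrite (_ : cylinder _ = cylinder s `&` (fun w : cantor_space => w (size s)) @^-1` [set b]).
  apply: openI => //.
  apply: open_comp; last exact: discrete_open.
  by move=> + _; exact: proj_continuous.
by apply/seteqP; split=> w /mem_cylinder_rcons.
Qed.

Lemma measurable_cylinder s : measurable (cylinder s).
Proof. by apply: sub_sigma_algebra; exact: open_cylinder. Qed.
#[local] Hint Resolve measurable_cylinder : core.

Section mass_theory.
Context {R : realType}.
Implicit Types nu mu : probability cantor R.

Lemma mass_ge0 nu s : 0 <= mass nu s.
Proof. exact: fine_ge0. Qed.

Lemma massE nu s : (mass nu s)%:E = nu (cylinder s).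
Proof. by rewrite /mass fineK// fin_num_measure. Qed.

Lemma mass_split nu s : mass nu s = mass nu (rcons s false) + mass nu (rcons s true).
Proof.
apply: EFin_inj; rewrite EFinD !massE {1}cylinder_split measureU//.
exact: cylinder_split_disjoint.
Qed.

(** The sets that contain or miss [cylinder s] form a sigma-algebra, and every cylinder of a string
    of length [n] is among them. *)
Lemma cylinder_filtration_dichotomy n (A : set cantor) s :
  cylinder_filtration n A -> size s = n ->
  A `&` cylinder s = cylinder s \/ A `&` cylinder s = set0.
Proof.
move=> FA sn.
suff : cylinder s `<=` A \/ A `&` cylinder s = set0 by move=> [/setIidr|] ->; [left|right].
apply: (FA [set B | cylinder s `<=` B \/ B `&` cylinder s = set0]); split.
  split=> [|B [sB|Bs]|B sB] /=.
  - by right; rewrite set0I.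
  - by right; apply/seteqP; split=> w // [[_ nB] /sB].
  - by left=> w sw; split=> // Bw; have : (B `&` cylinder s) w by []; rewrite Bs.
  - have [[k sBk]|nsB] := pselect (exists k, cylinder s `<=` B k).
      by left=> w sw; exists k => //; exact: sBk.
    right; rewrite setI_bigcupl bigcup0// => k _.
    by case: (sB k) => // sBk; exfalso; apply: nsB; exists k.
move=> _ [t /= tn <-]; have [->|ts] := eqVneq t s; first by left.
right; apply/seteqP; split=> w // [].
by rewrite /cylinder/= tn sn => -> /eqP; rewrite (negbTE ts).
Qed.

(** Inside the cylinder of the prefix, an event of the filtration is empty, everything, or one of
    the two children. The first two give difference 0, and the two children give equal differences
    since their conditional probabilities add up to 1. *)
Lemma cond_tv_prefix nu mu n w : full_support nu -> full_support mu ->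
  0 <= cond_tv (cylinder_filtration n.+1) nu mu n w <=
  `|mass nu (rcons (prefix_of w n) false) / mass nu (prefix_of w n)
    - mass mu (rcons (prefix_of w n) false) / mass mu (prefix_of w n)|.
Proof.
move=> nu0 mu0; set s := prefix_of w n; set d := `|_|.
have nus := nu0 s; have mus := mu0 s; have d0 : 0 <= d by exact: normr_ge0.
rewrite /cond_tv; set E := (X in sup X).
have E0 : E 0.
  exists set0; last by rewrite /cond_prob !set0I !measure0 !mul0r subrr normr0.
  exact: sigma_algebra0.
have Ed : ubound E d.
  move=> _ [A FA <-].
  have FAb b : A `&` cylinder (rcons s b) = cylinder (rcons s b) \/
      A `&` cylinder (rcons s b) = set0.
    by apply: cylinder_filtration_dichotomy FA _; rewrite size_rcons size_prefix_of.
  rewrite /cond_prob -/s.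
  have -> : A `&` cylinder s = (A `&` cylinder (rcons s false)) `|` (A `&` cylinder (rcons s true)).
    by rewrite {1}cylinder_split setIUr.
  case: (FAb false) => ->; case: (FAb true) => ->.
  - by rewrite -cylinder_split -!/(mass _ _) !divff ?gt_eqF// subrr normr0.
  - by rewrite setU0 -!/(mass _ _).
  - rewrite set0U -!/(mass _ _).
    have compl (lam : probability cantor R) : 0 < mass lam s ->
        mass lam (rcons s true) / mass lam s =
        1 - mass lam (rcons s false) / mass lam s.
      by move=> lams; rewrite (mass_split lam s); field; rewrite -mass_split gt_eqF.
    have sub11 (x y : R) : 1 - x - (1 - y) = y - x by ring.
    by rewrite !compl// sub11 distrC.
  - by rewrite setU0 !measure0 !mul0r subrr normr0.
apply/andP; split; last by apply: ge_sup => //; exists 0.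
by apply: ub_le_sup => //; exists d.
Qed.

Lemma CR_bounded nu w N : CR nu w -> dyadic_martingale nu N ->
  string_creal N -> (forall s, 0 <= N s) ->
  exists C, forall n, N (prefix_of w n) <= C.
Proof.
move=> + mN cN N0 => /(_ N mN (creal_uniformly_computable cN) N0).
set S := ereal_sup _ => Soo.
have NS n : ((N (prefix_of w n))%:E <= S)%E by apply: ereal_sup_ubound; exists n.
exists (fine S) => n; rewrite -lee_fin fineK//.
by rewrite ge0_fin_numE//; apply: le_trans (NS 0%N); rewrite lee_fin.
Qed.
End mass_theory.

(** * Sums over the extensions of a string *)

Section extension_sum_limit.
Context {R : realType}.
Context (f : seq bool -> R)
  (f_le : forall s, f s <= f (rcons s false) + f (rcons s true)).

Lemma extension_sum_le s : {homo (extension_sum f)^~ s : i j / (i <= j)%N >-> i <= j}.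
Proof.
apply/nondecreasing_seqP => j; elim: j s => [|j ih] s //=.
by apply: lerD; exact: ih.
Qed.

(** The increment at [s] is one summand of the increment at the root between levels [i + size s] and
    [j + size s], and by [extension_sum_le] all these summands are nonnegative. This makes the
    convergence uniform in [s]. *)
Lemma extension_sum_increment_le i j s : (i <= j)%N ->
  extension_sum f j s - extension_sum f i s <=
  extension_sum f (j + size s) [::] - extension_sum f (i + size s) [::].
Proof.
elim/last_ind: s i j => [|s b ih] i j ij /=; first by rewrite !addn0.
rewrite size_rcons !addnS -!addSn; apply: le_trans (ih _ _ _) => //=.
have := extension_sum_le (rcons s false) ij.
have := extension_sum_le (rcons s true) ij.
by case: b => /=; lra.
Qed.

Context (r : R) (f_cvg : (extension_sum f)^~ [::] @ \oo --> r).

Lemma extension_sum_nil_le j : extension_sum f j [::] <= r.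
Proof.
rewrite -(cvg_lim _ f_cvg)//; apply: nondecreasing_cvgn_le.
  exact: extension_sum_le.
by apply/cvg_ex; exists r.
Qed.

Lemma extension_sum_sub_le i j s : (i <= j)%N ->
  extension_sum f j s - extension_sum f i s <= r - extension_sum f i [::].
Proof.
move=> ij; apply: le_trans (extension_sum_increment_le s ij) _.
apply: lerB; first exact: extension_sum_nil_le.
by apply: extension_sum_le; rewrite leq_addr.
Qed.

(** When [f] is [mass nu] times a running maximum of nonnegative values, this stands for the
    integral over [cylinder s] of the supremum. As a limit of finite sums it is additive in [s] and
    accessible to computation. *)
Definition extension_limit s := limn ((extension_sum f)^~ s).

Lemma cvg_extension_sum s : (extension_sum f)^~ s @ \oo --> extension_limit s.
Proof.
apply: nondecreasing_is_cvgn; first exact: extension_sum_le.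
exists (r - extension_sum f 0 [::] + extension_sum f 0 s) => _ [j _ <-].
by rewrite -lerBlDr; exact: extension_sum_sub_le.
Qed.

Lemma extension_limit_split s : extension_limit s =
  extension_limit (rcons s false) + extension_limit (rcons s true).
Proof.
have := @cvg_extension_sum s; rewrite -cvg_shiftS => cs.
apply: cvg_unique cs _ => //.
exact: cvgD (@cvg_extension_sum (rcons s false)) (@cvg_extension_sum (rcons s true)).
Qed.

Lemma extension_limit_ge j s : extension_sum f j s <= extension_limit s.
Proof.
apply: nondecreasing_cvgn_le; first exact: extension_sum_le.
by apply/cvg_ex; exists (extension_limit s); exact: cvg_extension_sum.
Qed.

Lemma extension_limit_sub_le j s :
  extension_limit s - extension_sum f j s <= r - extension_sum f j [::].
Proof.
rewrite lerBlDr; apply: limr_le.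
  by apply/cvg_ex; exists (extension_limit s); exact: cvg_extension_sum.
by exists j => // i /= ji; rewrite -lerBlDr; exact: extension_sum_sub_le.
Qed.
End extension_sum_limit.

(** Search for an index at which the approximations of [r] and [u j], scaled by [2 ^ n.+2], satisfy
    [b <= a + 2]. Closeness within [2 ^- n.+2] forces this, and with two errors of 1 it gives a
    scaled gap of at most 4. *)
Lemma creal_modulus (R : realType) (u : nat -> R) (r : R) :
  creal 1 (fun v => u (nth 0%N v 0)) -> creal 0 (fun=> r) -> u @ \oo --> r ->
  exists2 m, seq_recursive 1 m & forall n, r - u (m [:: n]) <= 2 ^- n.
Proof.
move=> [a ra ua] [b rb rb'] ur.
have [||m rm mP] := @seq_recursive_search 1
  (fun j v => b (nth 0%N v 0).+2 [::] <= a (nth 0%N v 0).+2 [:: j] + 2)%N.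
- apply: seq_recursive_leq.
    apply: (@seq_recursive_subst 1 2 _ (fun v => [:: (nth 0%N (behead v) 0).+2])) rb => //.
    by move=> [|i] _; seq_rec.
  apply: seq_recursiveD; last by seq_rec.
  apply: (@seq_recursive_subst 2 2 _
    (fun v => [:: (nth 0%N (behead v) 0).+2; nth 0%N v 0])) ra => //.
  by move=> [|[|i]] _; seq_rec.
- move=> v _; move: (nth _ _ _) => n.
  have e0 : 0 < 2 ^+ n.+2 :> R by rewrite exprn_gt0.
  move/cvgrPdist_lt: ur => /(_ (2 ^- n.+2)); rewrite invr_gt0.
  move=> /(_ e0)[j _ /(_ j (leqnn j)) /= urj].
  exists j; rewrite -ltnS -(ltr_nat R).
  have := rb' n.+2 [::] erefl; have := ua n.+2 [:: j] erefl => /=.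
  rewrite -(natr1 (_ + _)) natrD !ler_norml => /andP[h1 h2] /andP[h3 h4].
  have : (r - u j) * 2 ^+ n.+2 < 1.
    rewrite -ltr_pdivlMr// mul1r; apply: le_lt_trans urj.
    exact: ler_norm.
  by lra.
exists m => // n; have := mP [:: n] erefl; rewrite -(ler_nat R) natrD /=.
have := rb' n.+2 [::] erefl; have := ua n.+2 [:: m [:: n]] erefl => /=.
rewrite !exprS !ler_norml => /andP[h1 h2] /andP[h3 h4] h5.
have e0 : 0 < 2 ^+ n :> R by rewrite exprn_gt0.
by rewrite -[leRHS]mul1r ler_pdivlMr//; lra.
Qed.

(** A modulus for the convergence to [r] at the empty string is, by [extension_limit_sub_le], a
    modulus at every string. *)
Lemma string_creal_extension_limit (R : realType) (f : seq bool -> R) (r : R) :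
  (forall s, f s <= f (rcons s false) + f (rcons s true)) ->
  (extension_sum f)^~ [::] @ \oo --> r -> string_creal f -> creal 0 (fun=> r) ->
  string_creal (extension_limit f).
Proof.
move=> f_le fr cf cr; have cS := creal_extension_sum cf.
have [|m rm mP] := creal_modulus _ cr fr.
  have := creal2 (g := fun v => nth 0%N v 0) (h := fun=> 0%N)
    (f := fun j c => extension_sum f j (string_of_code c)) cS
    (seq_recursive_nth 1 0) (seq_recursive_const 1 0).
  by rewrite (string_codeK [::]).
apply: (creal_lim (F := fun n v => extension_sum f (m [:: n]) (string_of_code (nth 0%N v 0)))).
  apply: (creal2 (f := fun j c => extension_sum f j (string_of_code c))
    (g := fun v => m [:: nth 0%N v 0]) (h := fun v => nth 0%N (behead v) 0)) => //; last by seq_rec.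
  apply: (@seq_recursive_subst 1 2 _ (fun v => [:: nth 0%N v 0])) rm => //.
  by move=> [|i] _; seq_rec.
move=> n v _; rewrite ger0_norm ?subr_ge0.
  exact: le_trans (extension_limit_sub_le f_le fr _ _) (mP n).
exact: (extension_limit_ge f_le fr).
Qed.

(** * Integrals of functions of prefixes *)

Section prefix_integral.
Context {R : realType} (nu : probability cantor R).

(** Each preimage is a union of cylinders, hence open. *)
Lemma measurable_prefix (g : seq bool -> \bar R) n (A : set cantor) :
  measurable A -> measurable_fun A (fun w => g (prefix_of w n)).
Proof.
move=> mA _ Y mY; apply: measurableI => //.
apply: sub_sigma_algebra.
rewrite (_ : _ @^-1` _ = \bigcup_(t in [set t | size t = n /\ Y (g t)]) cylinder t).
  by apply: bigcup_open => t _; exact: open_cylinder.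
apply/seteqP; split=> [w Yw|w [t [tn Yt] tw]] /=.
  by exists (prefix_of w n); rewrite /= /cylinder/= size_prefix_of.
by rewrite -tn tw.
Qed.

Lemma integral_prefix (g : seq bool -> R) j s : (forall t, 0 <= g t) ->
  (\int[nu]_(w in cylinder s) (g (prefix_of w (size s + j)))%:E =
   (extension_sum (fun t => mass nu t * g t) j s)%:E)%E.
Proof.
move=> g0; elim: j s => [|j ih] s.
  rewrite addn0 (eq_integral (cst (g s)%:E)).
    by rewrite integral_cst//= EFinM massE muleC.
  by move=> w /[!inE] /= ->.
rewrite {1}cylinder_split ge0_integral_setU//=.
- rewrite EFinD -!ih !size_rcons !addSnnS.
  by [].
- by apply: (measurable_prefix (fun t => (g t)%:E)); exact: measurableU.
- by move=> w _; rewrite lee_fin.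
- by apply/disj_setPS; rewrite cylinder_split_disjoint.
Qed.

(** Monotone convergence for the running maxima, which depend on finite prefixes and increase to the
    supremum. Starting the maxima at 0 is harmless for nonnegative [g]. *)
Lemma cvg_integral_bigmax_prefix (g : seq bool -> R) : (forall t, 0 <= g t) ->
  (fun j => (extension_sum (fun t => mass nu t *
     \big[Num.max/0]_(n < (size t).+1) g (take n t)) j [::])%:E) @ \oo -->
  (\int[nu]_w ereal_sup (range (fun n => (g (prefix_of w n))%:E)))%E.
Proof.
move=> g0; set P := fun t => \big[Num.max/0]_(n < (size t).+1) g (take n t).
have P0 t : 0 <= P t by exact: bigmax_ge_id.
have Pmono w : nondecreasing_seq (fun n => (P (prefix_of w n))%:E).
  move=> m n mn; rewrite lee_fin; apply/bigmax_leP; split=> // i _.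
  have im : (i <= m)%N by have := ltn_ord i; have := size_prefix_of w m; lia.
  rewrite take_prefix_of// -(take_prefix_of w (leq_trans im mn)).
  have in1 : (i < (size (prefix_of w n)).+1)%N by rewrite (size_prefix_of w n) ltnS (leq_trans im).
  exact: (le_bigmax _ (fun k : 'I_(size (prefix_of w n)).+1 => g (take k (prefix_of w n)))
    (Ordinal in1)).
have Plim w : limn (fun n => (P (prefix_of w n))%:E) =
    ereal_sup (range (fun n => (g (prefix_of w n))%:E)).
  set S := ereal_sup _; rewrite (cvg_lim _ (ereal_nondecreasing_cvgn (Pmono w)))//.
  have gS n : ((g (prefix_of w n))%:E <= S)%E.
    by apply: ereal_sup_ubound; exists n.
  apply/eqP; rewrite eq_le; apply/andP; split; apply: ge_ereal_sup => _ [n _ <-].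
    move: gS; case: S => [x gS|_|/(_ 0%N)//]; last exact: leey.
    rewrite lee_fin; apply/bigmax_leP; split=> [|i _].
      by have := gS 0%N; rewrite lee_fin; exact: le_trans.
    have := gS i; rewrite lee_fin take_prefix_of//.
    by have := ltn_ord i; have := size_prefix_of w n; lia.
  apply: le_trans (ereal_sup_ubound _); last by exists n.
  rewrite lee_fin.
  have in1 : (n < (size (prefix_of w n)).+1)%N by rewrite size_prefix_of.
  have := le_bigmax 0 (fun k : 'I_(size (prefix_of w n)).+1 => g (take k (prefix_of w n)))
    (Ordinal in1).
  by rewrite /= take_prefix_of.
rewrite -(eq_integral _ _ (fun w _ => Plim w)).
have -> : (fun j => (extension_sum (fun t => mass nu t * P t) j [::])%:E) =
    (fun j => \int[nu]_w (P (prefix_of w j))%:E)%E.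
  by apply/funext => j; rewrite -integral_prefix// cylinder_nil.
apply: cvg_monotone_convergence => //.
- by move=> n; exact: (measurable_prefix (fun t => (P t)%:E)).
- by move=> n w _; rewrite lee_fin.
Qed.
End prefix_integral.

(** * Likelihood ratios along computably random points *)

Section likelihood_ratio.
Context {R : realType}.
Implicit Types nu mu : probability cantor R.

Lemma computable_mass_creal nu : computable_measure nu -> string_creal (mass nu).
Proof. by apply: uniformly_computable_creal => s; exact: mass_ge0. Qed.

(** The dominating martingale is [extension_limit h / mass nu], where [h] is [mass nu] times the
    running maximum [P] of the ratio [D]. *)
Lemma CR_likelihood_ratio_bounded nu mu w :
  computable_measure nu -> full_support nu ->
  computable_measure mu -> full_support mu -> bdc nu mu -> CR nu w ->
  exists C, forall n, mass nu (prefix_of w n) / mass mu (prefix_of w n) <= C.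
Proof.
move=> cnu nu0 cmu mu0 [r cr intr] CRw.
pose D t := mass nu t / mass mu t.
pose P t := \big[Num.max/0]_(n < (size t).+1) D (take n t).
pose h t := mass nu t * P t.
have D0 t : 0 <= D t by rewrite divr_ge0// mass_ge0.
have P0 t : 0 <= P t by exact: bigmax_ge_id.
have hr : (extension_sum h)^~ [::] @ \oo --> r.
  have : (extension_sum h j [::])%:E @[j --> \oo] --> r%:E.
    by rewrite -intr; exact: (@cvg_integral_bigmax_prefix R nu D D0).
  exact: fine_cvg.
have DP t : D t <= P t.
  have := le_bigmax 0 (fun n : 'I_(size t).+1 => D (take n t)) ord_max.
  by rewrite /= take_size.
have PP s b : P s <= P (rcons s b).
  apply/bigmax_leP; split=> // i _.
  have i1 : (i < (size (rcons s b)).+1)%N by rewrite size_rcons; have := ltn_ord i; lia.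
  have -> : take i s = take i (rcons s b) by rewrite -cats1 takel_cat// -ltnS.
  exact: (le_bigmax 0 (fun n : 'I_(size (rcons s b)).+1 => D (take n (rcons s b))) (Ordinal i1)).
(* The mass splits over the children while the running maximum can only grow. *)
have h_le s : h s <= h (rcons s false) + h (rcons s true).
  by rewrite /h (mass_split nu s) mulrDl lerD// ler_wpM2l// mass_ge0.
have cD : string_creal D.
  apply: crealM; first exact: computable_mass_creal.
  by apply: creal_inv => [s _|]; [exact: mu0|exact: computable_mass_creal].
have ch : string_creal h.
  apply: crealM; first exact: computable_mass_creal.
  exact: string_creal_bigmax_take.
have r0 : 0 <= r.
  apply: le_trans (extension_sum_nil_le h_le hr 0) => /=.
  by rewrite mulr_ge0// mass_ge0.
have hI s : h s <= extension_limit h s by exact: (extension_limit_ge h_le hr 0).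
have h0 s : 0 <= h s by rewrite mulr_ge0// mass_ge0.
have [|||C NC] := @CR_bounded R nu w (fun s => extension_limit h s / mass nu s) CRw.
- move=> s; rewrite (extension_limit_split h_le hr).
  have := nu0 s; have := nu0 (rcons s false); have := nu0 (rcons s true).
  by move=> *; field; rewrite !gt_eqF.
- apply: crealM.
    exact: string_creal_extension_limit h_le hr ch (computable_real_creal r0 cr).
  by apply: creal_inv => [s _|]; [exact: nu0|exact: computable_mass_creal].
- by move=> s; rewrite divr_ge0 ?mass_ge0// (le_trans (h0 s)).
exists C => n; apply: le_trans (NC n); rewrite ler_pdivlMr; last exact: nu0.
apply: le_trans (hI _); rewrite mulrC ler_wpM2l ?mass_ge0//.
exact: DP.
Qed.

Lemma CR_inverse_likelihood_ratio_bounded nu mu w :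
  computable_measure nu -> full_support nu ->
  computable_measure mu -> CR nu w ->
  exists C, forall n, mass mu (prefix_of w n) / mass nu (prefix_of w n) <= C.
Proof.
move=> cnu nu0 cmu CRw.
apply: (@CR_bounded R nu w (fun s => mass mu s / mass nu s) CRw).
- move=> s; rewrite (mass_split mu s).
  have := nu0 s; have := nu0 (rcons s false); have := nu0 (rcons s true).
  by move=> *; field; rewrite !gt_eqF.
- apply: crealM; first exact: computable_mass_creal.
  by apply: creal_inv => [s _|]; [exact: nu0|exact: computable_mass_creal].
- by move=> s; rewrite divr_ge0 ?mass_ge0.
Qed.

(* [a], [b] and [c], [d] are the masses of the two children of a string under
   [nu] and [mu]; the right-hand side is the gap in Jensen's conditional
   inequality for [phi x = x / (1 + x)] at [mu / nu]. *)
Lemma jensen_gap_ge (a b c d : R) : 0 < a -> 0 < b -> 0 < c -> 0 < d ->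
  (a / (a + b) - c / (c + d)) ^+ 2 * (((c + d) / (a + b)) ^+ 2 / (1 + (c + d) / (a + b)) ^+ 3)
  <= (c + d) / (c + d + (a + b))
     - (c / (c + a) * (a / (a + b)) + d / (d + b) * (b / (a + b))).
Proof.
move=> a0 b0 c0 d0.
(* Both sides share the factor [(a * d - b * c) ^+ 2 / ((a + b) * (c + d + (a + b)))]; it remains to
   bound [(c + a) * (d + b)] by the square of the total [c + d + (a + b)]. *)
have -> : (c + d) / (c + d + (a + b))
     - (c / (c + a) * (a / (a + b)) + d / (d + b) * (b / (a + b))) =
  (a * d - b * c) ^+ 2 / ((a + b) * (c + d + (a + b))) * ((c + a) * (d + b))^-1.
  by field; rewrite !gt_eqF ?addr_gt0.
have -> : (a / (a + b) - c / (c + d)) ^+ 2 *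
    (((c + d) / (a + b)) ^+ 2 / (1 + (c + d) / (a + b)) ^+ 3) =
  (a * d - b * c) ^+ 2 / ((a + b) * (c + d + (a + b))) * ((c + d + (a + b)) ^+ 2)^-1.
  by field; rewrite !gt_eqF ?addr_gt0.
apply: ler_wpM2l.
  by rewrite divr_ge0 ?sqr_ge0// ltW// mulr_gt0 ?addr_gt0.
rewrite lef_pV2 ?posrE ?exprn_gt0 ?mulr_gt0 ?addr_gt0//.
have := sqr_ge0 (c + a); have := sqr_ge0 (d + b).
have : 0 <= (c + a) * (d + b) by rewrite ltW// mulr_gt0 ?addr_gt0.
have -> : (c + d + (a + b)) ^+ 2 = (c + a) ^+ 2 + (d + b) ^+ 2 + 2 * ((c + a) * (d + b)) by ring.
by move=> *; lra.
Qed.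

Lemma CR_cond_prob_sub_cvg nu mu w :
  computable_measure nu -> full_support nu ->
  computable_measure mu -> full_support mu -> bdc nu mu -> CR nu w ->
  (fun n => mass nu (rcons (prefix_of w n) false) / mass nu (prefix_of w n)
    - mass mu (rcons (prefix_of w n) false) / mass mu (prefix_of w n)) @ \oo --> (0 : R).
Proof.
move=> cnu nu0 cmu mu0 numu CRw.
have [C1 DC1] := CR_likelihood_ratio_bounded cnu nu0 cmu mu0 numu CRw.
have [C2 MC2] := CR_inverse_likelihood_ratio_bounded cnu nu0 cmu CRw.
have cnu' := computable_mass_creal cnu; have cmu' := computable_mass_creal cmu.
(* This is [x / (1 + x)] at [x = mass mu s / mass nu s], with denominators cleared. *)
pose phi s := mass mu s / (mass mu s + mass nu s).
pose Ephi s := phi (rcons s false) * (mass nu (rcons s false) / mass nu s) +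
  phi (rcons s true) * (mass nu (rcons s true) / mass nu s).
pose gap s := phi s - Ephi s.
have phi0 s : 0 <= phi s by rewrite divr_ge0 ?addr_ge0 ?mass_ge0.
pose p s := mass nu (rcons s false) / mass nu s - mass mu (rcons s false) / mass mu s.
pose m s := mass mu s / mass nu s.
have m0 s : 0 < m s by rewrite divr_gt0 ?nu0 ?mu0.
have gapge s : (p s) ^+ 2 * (m s ^+ 2 / (1 + m s) ^+ 3) <= gap s.
  rewrite /p /m /gap /Ephi /phi (mass_split nu s) (mass_split mu s).
  by apply: jensen_gap_ge; rewrite ?nu0 ?mu0.
have gap0 s : 0 <= gap s.
  apply: le_trans (gapge s).
  by rewrite mulr_ge0 ?sqr_ge0// divr_ge0 ?exprn_ge0 ?addr_ge0// ltW.
have cphi : string_creal phi.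
  apply: crealM => //; apply: creal_inv => [s _|]; last exact: crealD.
  by rewrite addr_gt0 ?nu0 ?mu0.
have crcons b : string_creal (fun s => phi (rcons s b) * (mass nu (rcons s b) / mass nu s)).
  apply: crealM; first exact: string_creal_rcons.
  apply: crealM; first exact: string_creal_rcons.
  by apply: creal_inv => // s _; exact: nu0.
have cgap : string_creal gap.
  apply: crealB => //; last by apply: crealD; exact: crcons.
  by move=> v _; rewrite -subr_ge0; exact: gap0.
pose X s := phi s + \sum_(n < size s) gap (take n s).
have [|||C XC] := @CR_bounded R nu w X CRw.
(* Both children of [s] carry the same sum of gaps, and its last term [gap s] makes up for the drop
   from [phi s] to [Ephi s]. *)
- move=> s; rewrite /X !size_rcons !big_ord_recr/=.
  have tk b : \sum_(i < size s) gap (take i (rcons s b)) = \sum_(i < size s) gap (take i s).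
    by apply: eq_bigr => i _; rewrite -cats1 takel_cat// ltnW.
  rewrite !tk -!cats1 !take_size_cat//; set B := \sum_(_ < _) _.
  have : gap s = phi s - Ephi s by [].
  have := nu0 s; rewrite /Ephi !cats1 (mass_split nu s).
  move: (phi s) (phi _) (phi _) (gap s) (mass nu _) (mass nu _) B => x y z g a b B ab0 ->.
  by field; rewrite gt_eqF.
- by apply: crealD => //; exact: string_creal_sum_take.
- by move=> s; rewrite addr_ge0// sumr_ge0.
(* As [phi] is nonnegative, the bound on [X] also bounds the partial sums of the gaps. *)
have cgap0 : (fun n => gap (prefix_of w n)) @ \oo --> (0 : R).
  apply: cvg_series_cvg_0; apply: nondecreasing_is_cvgn.
    by apply: nondecreasing_series => n _ _; exact: gap0.
  exists C => _ [n _ <-]; apply: le_trans (XC n).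
  rewrite /X size_prefix_of /series/= big_mkord.
  rewrite ler_wpDl// ler_sum// => i _.
  by rewrite take_prefix_of// ltnW.
have C10 : 0 < C1 by apply: lt_le_trans (DC1 0%N); rewrite divr_gt0 ?nu0 ?mu0.
have C20 : 0 < C2 by apply: lt_le_trans (MC2 0%N); exact: m0.
(* A lower bound for [m ^+ 2 / (1 + m) ^+ 3] along [w], from [C1^-1 <= m <= C2]; the left inequality
   is the bound [C1] on the inverse ratio. *)
pose K := C1 ^- 2 / (1 + C2) ^+ 3.
have K0 : 0 < K by rewrite divr_gt0 ?invr_gt0 ?exprn_gt0 ?addr_gt0.
have pK n : (p (prefix_of w n)) ^+ 2 * K <= gap (prefix_of w n).
  apply: le_trans (gapge _); rewrite ler_wpM2l ?sqr_ge0//.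
  rewrite ler_pM ?invr_ge0 ?exprn_ge0 ?addr_ge0 ?(ltW C10) ?(ltW C20)//.
    rewrite -exprVn lerXn2r ?nnegrE ?invr_ge0 ?(ltW C10) ?(ltW (m0 _))//.
    rewrite -[m _]invrK lef_pV2 ?posrE ?invr_gt0//.
    by rewrite /m invf_div; exact: DC1.
  rewrite lef_pV2 ?posrE ?exprn_gt0 ?addr_gt0//.
  by rewrite lerXn2r ?nnegrE ?addr_ge0 ?(ltW C20) ?(ltW (m0 _))// lerD2l; exact: MC2.
apply/cvgrPdist_lt => e e0.
(* Once the gap is below [e ^+ 2 * K], [pK] bounds the square of [p] by that of [e]. *)
have eK : 0 < e ^+ 2 * K by rewrite mulr_gt0 ?exprn_gt0.
move/cvgrPdist_lt: cgap0 => /(_ _ eK); apply: filterS => n.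
rewrite !sub0r !normrN (ger0_norm (gap0 _)) => /(le_lt_trans (pK n)).
rewrite ltr_pM2r// -(real_normK (num_real (p _))).
by rewrite ltr_pXn2r// nnegrE ltW.
Qed.
End likelihood_ratio.

Local Close Scope ring_scope.

Theorem theorem1p19 (R : realType) (nu : probability cantor R)
    (nu_comp : computable_measure nu) (nu_full : full_support nu) :
  Mild nu `&` CR nu `<=` MR0 bdc (fun n => cylinder_filtration n.+1) nu.
Proof.
move=> w [_ CRw] mu mu_comp mu_full numu.
have /cvg_norm := CR_cond_prob_sub_cvg nu_comp nu_full mu_comp mu_full numu CRw.
rewrite normr0 => cvg0.
apply: squeeze_cvgr (cvg_cst 0%R) cvg0.
by apply: nearW => n; exact: cond_tv_prefix.
Qed.
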